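(* The map $\mathcal{Q}_2\to\mathcal{D}\rtimes^{e}_{\alpha}(\mathbb{Z}\rtimes[2\rangle)$ given by $$u^ls_2^i\mapsto w_{(l,2^i)}\qquad (l\in\mathbb{Z},\ i\in\mathbb{N}_0)$$ is an isomorphism of $C^*$-algebras.
   Context: $\mathcal{Q}_2$ is the universal unital $C^*$-algebra generated by a unitary $u$ and an isometry $s_2$ with $s_2u=u^2s_2$ and $s_2s_2^*+us_2s_2^*u^{-1}=1$. Put $e_{2^i}=s_2^i(s_2^i)^*$ and let $\mathcal{D}$ be the $C^*$-subalgebra of $\mathcal{Q}_2$ generated by $\{u^le_{2^i}u^{-l}: l\in\mathbb{Z},i\in\mathbb{N}_0\}$. $[2\rangle=\{1,2,2^2,\dots\}$, and $\mathbb{Z}\rtimes[2\rangle$ is the semigroup with operation $(l,2^i)(n,2^j)=(l+2^in,2^{i+j})$. It acts on $\mathcal{D}$ by the endomorphisms $\alpha_{(l,2^i)}(f)=u^ls_2^i\,f\,(u^ls_2^i)^*$. Semigroup crossed product: for an action $\alpha$ of a discrete semigroup $P$ with identity by (not necessarily unital) endomorphisms of a unital $C^*$-algebra $D$, $D\rtimes^e_\alpha P$ is the universal $C^*$-algebra for covariant pairs $(\pi,W)$, where $\pi$ is a (unital) representation of $D$ on a Hilbert space, $W$ is a homomorphism from $P$ to the semigroup of isometries on that space, and $\pi(\alpha_q(a))=W_q\pi(a)W_q^*$ for all $a\in D$, $q\in P$. The universal covariant pair is denoted $(\iota_D,w)$, so the $w_q$, $q\in P$, are the canonical isometries in $D\rtimes^e_\alpha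 P$. *)

(* Defs.v *)
From HB Require Import structures.
From mathcomp Require Import all_boot all_order all_algebra.
From mathcomp Require Import all_classical reals topology normedtype.
From mathcomp Require Import complex.

Set Implicit Arguments.
Unset Strict Implicit.
Unset Printing Implicit Defensive.

Import Order.TTheory GRing.Theory Num.Theory.
Import numFieldNormedType.Exports.

Local Open Scope classical_set_scope.
Local Open Scope complex_scope.
Local Open Scope ring_scope.

(* Complex Hilbert spaces; [hdot] is linear in its first argument. *)
Record hilbertType (R : realType) := Hilbert {
  hsort :> completeNormedModType R[i];
  hdot : {dot hsort for (@Num.conj R[i])};
  hdot_norm : forall x : hsort, `|x| ^+ 2 = hdot x x }.
Arguments hdot {R} h.

(* Operators on H are plain functions H -> H. *)
Definition bounded_op (R : realType) (H : hilbertType R) : set (H -> H) :=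
  [set T | (forall (c : R[i]) x y, T (c *: x + y) = c *: T x + T y) /\
           exists M : R[i], forall x, `|T x| <= M * `|x|].

Definition is_adjoint (R : realType) (H : hilbertType R) (T T' : H -> H) :=
  forall x y, hdot H (T x) y = hdot H x (T' y).

(* T^*; an adjoint is unique if it exists, and every bounded operator has one.
   For a function without an adjoint the value is a dummy. *)
Definition adj (R : realType) (H : hilbertType R) (T : H -> H) : H -> H :=
  xget (fun=> 0) [set T' | is_adjoint T T'].

(* A C*-algebra is a norm-closed *-subalgebra of the bounded operators on a
   Hilbert space; a unital one is taken to act nondegenerately, so that its unit
   is the identity operator. *)
Record unital_cstar (R : realType) (H : hilbertType R) (A : set (H -> H)) :
    Prop := UnitalCstar {
  cstar_bounded : A `<=` @bounded_op R H;
  cstar_unit : A idfun;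
  cstar_add : forall S T, A S -> A T -> A (S \+ T);
  cstar_scale : forall (c : R[i]) T, A T -> A (fun x => c *: T x);
  cstar_mul : forall S T, A S -> A T -> A (S \o T);
  cstar_adj : forall T, A T -> exists2 T', A T' & is_adjoint T T';
  cstar_closed : forall T : H -> H,
    (forall e : R[i], 0 < e ->
       exists2 S, A S & forall x, `|T x - S x| <= e * `|x|) -> A T }.

(* The C*-algebra generated by G, and 1. *)
Definition gen_cstar (R : realType) (H : hilbertType R) (G : set (H -> H)) :
    set (H -> H) :=
  [set T | forall A, unital_cstar A -> G `<=` A -> A T].

(* Unital *-homomorphism from A to B; the values of phi outside A are
   irrelevant. *)
Record star_hom (R : realType) (H K : hilbertType R) (A : set (H -> H))
    (B : set (K -> K)) (phi : (H -> H) -> (K -> K)) : Prop := StarHom {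
  shom_codom : forall T, A T -> B (phi T);
  shom_unit : phi idfun = idfun;
  shom_add : forall S T, A S -> A T -> phi (S \+ T) = phi S \+ phi T;
  shom_scale : forall (c : R[i]) T, A T ->
    phi (fun x => c *: T x) = (fun y => c *: phi T y);
  shom_mul : forall S T, A S -> A T -> phi (S \o T) = phi S \o phi T;
  shom_adj : forall T, A T -> is_adjoint (phi T) (phi (adj T)) }.

Definition star_iso (R : realType) (H K : hilbertType R) (A : set (H -> H))
    (B : set (K -> K)) (phi : (H -> H) -> (K -> K)) : Prop :=
  star_hom A B phi /\ set_bij A B phi.

Definition representation (R : realType) (H K : hilbertType R)
    (A : set (H -> H)) (pi : (H -> H) -> (K -> K)) : Prop :=
  star_hom A (@bounded_op R K) pi.

Record covariant_pair (R : realType) (P : monoidType) (H K : hilbertType R)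
    (D : set (H -> H)) (alpha : P -> (H -> H) -> (H -> H))
    (pi : (H -> H) -> (K -> K)) (W : P -> K -> K) : Prop := CovariantPair {
  cov_rep : representation D pi;
  cov_linear : forall q (c : R[i]) x y,
    W q (c *: x + y) = c *: W q x + W q y;
  cov_isometry : forall q x, `|W q x| = `|x|;
  cov_one : W 1%g = idfun;
  cov_mul : forall p q, W (p * q)%g = W p \o W q;
  cov_covariant : forall q a, D a ->
    pi (alpha q a) = W q \o pi a \o adj (W q) }.

(* (A, iota, w) is a semigroup crossed product of D by alpha. *)
Record is_crossed_product (R : realType) (P : monoidType) (H L : hilbertType R)
    (D : set (H -> H)) (alpha : P -> (H -> H) -> (H -> H))
    (A : set (L -> L)) (iota : (H -> H) -> (L -> L)) (w : P -> L -> L) :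
    Prop := IsCrossedProduct {
  cp_cstar : unital_cstar A;
  cp_covariant : covariant_pair D alpha iota w;
  cp_generated : A = gen_cstar ((iota @` D) `|` range w);
  cp_universal : forall (K : hilbertType R) (pi : (H -> H) -> (K -> K))
      (W : P -> K -> K), covariant_pair D alpha pi W ->
    exists rho : (L -> L) -> (K -> K),
      [/\ representation A rho, forall a, D a -> rho (iota a) = pi a
        & forall q, rho (w q) = W q] }.

Record Q2_relations (R : realType) (K : hilbertType R) (U S : K -> K) :
    Prop := Q2Relations {
  Q2_unitaryl : adj U \o U = idfun;
  Q2_unitaryr : U \o adj U = idfun;
  Q2_isometry : adj S \o S = idfun;
  Q2_comm : S \o U = U \o U \o S;
  Q2_sum : (S \o adj S) \+ (U \o S \o adj S \o adj U) = idfun }.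

Record is_Q2 (R : realType) (H : hilbertType R) (Q : set (H -> H))
    (u s : H -> H) : Prop := IsQ2 {
  Q2_cstar : unital_cstar Q;
  Q2_rel : Q2_relations u s;
  Q2_generated : Q = gen_cstar [set u; s];
  Q2_universal : forall (K : hilbertType R) (B : set (K -> K)) (U S : K -> K),
    unital_cstar B -> B U -> B S -> Q2_relations U S ->
    exists phi : (H -> H) -> (K -> K),
      [/\ star_hom Q B phi, phi u = U & phi s = S] }.

(* u ^ l for a unitary u. *)
Definition upow (R : realType) (H : hilbertType R) (u : H -> H) (l : int) :
    H -> H :=
  match l with Posz n => iter n u | Negz n => iter n.+1 (adj u) end.

Definition monomial (R : realType) (H : hilbertType R) (u s : H -> H)
    (l : int) (i : nat) : H -> H := upow u l \o iter i s.

Definition Dalg (R : realType) (H : hilbertType R) (u s : H -> H) :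
    set (H -> H) :=
  gen_cstar [set T | exists (l : int) (i : nat),
    T = upow u l \o (iter i s \o adj (iter i s)) \o upow u (- l)].

(* The semigroup of pairs (l, 2 ^ i), encoded by l and the exponent i. *)
Record Zpow2 : Type := ZPow2 { zshift : int; zexp : nat }.

Definition pair_of_Zpow2 (p : Zpow2) : int * nat := (zshift p, zexp p).
Definition Zpow2_of_pair (p : int * nat) : Zpow2 := ZPow2 p.1 p.2.

Fact pair_of_Zpow2K : cancel pair_of_Zpow2 Zpow2_of_pair.
Proof. by case. Qed.

HB.instance Definition _ := Choice.copy Zpow2 (can_type pair_of_Zpow2K).

Definition Zpow2_one : Zpow2 := ZPow2 0 0%N.

Definition Zpow2_mul (p q : Zpow2) : Zpow2 :=
  ZPow2 (zshift p + (2 ^ zexp p)%N%:Z * zshift q) (zexp p + zexp q)%N.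

Fact Zpow2_mulA : associative Zpow2_mul.
Proof.
move=> [l i] [m j] [n k]; rewrite /Zpow2_mul /= addnA; congr ZPow2.
by rewrite expnD PoszM mulrDr addrA mulrA.
Qed.

Fact Zpow2_mul1 : left_id Zpow2_one Zpow2_mul.
Proof. by move=> [l i]; rewrite /Zpow2_mul /= add0r mul1r add0n. Qed.

Fact Zpow2_mulr1 : right_id Zpow2_one Zpow2_mul.
Proof. by move=> [l i]; rewrite /Zpow2_mul /= mulr0 addr0 addn0. Qed.

HB.instance Definition _ :=
  isMonoid.Build Zpow2 Zpow2_mulA Zpow2_mul1 Zpow2_mulr1.

Definition alphaD (R : realType) (H : hilbertType R) (u s : H -> H)
    (q : Zpow2) (f : H -> H) : H -> H :=
  monomial u s (zshift q) (zexp q) \o f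
    \o adj (monomial u s (zshift q) (zexp q)).

(* Main.v *)
(* The universal property of Q_2 gives phi : Q_2 -> A once w_(1,1) and w_(0,2)
   are seen to satisfy its relations; the last relation holds because
   w_q w_q^* = iota (alpha_q 1) and iota is additive.  Conversely the inclusion
   of D and the monomials u^l s^i form a covariant pair on H, which gives
   rho : A -> Q_2.  Both composites fix the generators, hence are identities:
   a *-homomorphism is continuous, so two of them agree on a closed set.  For
   continuity, if |T| <= 1/2 then 1 - T^*T = C^2 with C a self-adjoint element
   of the algebra, so 1 - f(T)^* f(T) = f(C)^2 >= 0 and |f(T)| <= 1. *)
Require Import Defs.
From mathcomp Require Import all_boot all_order all_algebra.
From mathcomp Require Import all_classical reals topology normedtype.
From mathcomp Require Import complex sesquilinear ring zify.

Set Implicit Arguments.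
Unset Strict Implicit.
Unset Printing Implicit Defensive.

Import Order.TTheory GRing.Theory Num.Theory.
Import numFieldNormedType.Exports.

Local Open Scope classical_set_scope.
Local Open Scope complex_scope.
Local Open Scope ring_scope.

(** * Geometric bounds in normed spaces over [R[i]] *)

(** The order on [R[i]] is partial, but a positive element is real, so the archimedean property of
    [R] applies to its real part. *)
Lemma complex_half_expn (R : realType) (e : R[i]) :
  0 < e -> exists n : nat, 2^-1 ^+ n < e.
Proof.
move=> e0.
have eE : (complex.Re e)%:C = e by apply: RRe_real; exact: gtr0_real.
have re0 : 0 < complex.Re e by rewrite -ltcR eE.
exists (Num.bound (complex.Re e)^-1).
have h := @upper_nthrootP R (complex.Re e)^-1 _ (leqnn _).
have p2 : 0 < 2 ^+ Num.bound (complex.Re e)^-1 :> R by rewrite exprn_gt0.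
suff : ((2^-1 ^+ Num.bound (complex.Re e)^-1 : R)%:C < (complex.Re e)%:C).
  by rewrite eE rmorphXn /= fmorphV /= rmorph_nat.
by rewrite ltcR exprVn -[ltRHS]invrK ltf_pV2 // posrE invr_gt0.
Qed.

(** A stand-in for passing to a limit: several equalities of operators are proved pointwise by
    bounding a difference by multiples of [2^-1 ^+ n]. *)
Lemma le0_of_half_expn (R : realType) (V : normedModType R[i]) (x : V)
    (C : R[i]) :
  0 <= C -> (forall n : nat, `|x| <= 2^-1 ^+ n * C) -> x = 0.
Proof.
move=> C0 h; apply/eqP; rewrite -normr_le0 -[leRHS]add0r.
(* [C] may be 0, hence the division by [C + 1]. *)
have C1 : 0 < C + 1 by rewrite ltr_wpDl.
case: (eqVneq x 0) => [->|xN0]; first by rewrite normr0 addr0.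
have [n hn] : exists n : nat, 2^-1 ^+ n < `|x| / (C + 1).
  by apply: complex_half_expn; rewrite divr_gt0 // normr_gt0.
move: hn; rewrite ltr_pdivlMr // => /(le_lt_trans _) lt_x.
suff : `|x| < `|x| by rewrite ltxx.
by apply: lt_x; rewrite (le_trans (h n)) // ler_wpM2l ?lerDl // exprn_ge0 // invr_ge0.
Qed.

(** The tail of the geometric series sums to [2^-1 ^+ n * (2 * C)]. The explicit rate is kept so
    that pointwise limits of operators become norm limits. *)
Lemma geometric_cvg (R : realType) (V : completeNormedModType R[i])
    (y : nat -> V) (C : R[i]) :
  0 <= C -> (forall n, `|y n.+1 - y n| <= 2^-1 ^+ n * C) ->
  exists l : V, forall n, `|l - y n| <= 2^-1 ^+ n * (2 * C).
Proof.
move=> C0 hy.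
have dist n k : `|y (k + n)%N - y n| <= 2^-1 ^+ n * (2 * C).
  elim: k n => [|k IH] n.
    by rewrite subrr normr0 !mulr_ge0 // exprn_ge0 // invr_ge0.
  rewrite addSnnS -(subrKA (y n.+1)) (le_trans (ler_normD _ _)) //.
  rewrite (le_trans (lerD (IH _) (hy _))) // exprSr -mulrA (mulrA 2^-1).
  by rewrite mulVf ?pnatr_eq0 // mul1r -mulrDr mulr_natl mulr2n.
have cy : cvg (y @ \oo).
  apply/cauchy_cvgP/cauchy_exP => e e0.
  have C1 : 0 < 2 * C + 1 by rewrite ltr_wpDl // mulr_ge0.
  have [n hn] := @complex_half_expn R (e / (2 * C + 1)) (divr_gt0 e0 C1).
  exists (y n); exists n => // m /= nm; rewrite -ball_normE /= distrC.
  move: hn; rewrite ltr_pdivlMr // mulrDr mulr1 => /(le_lt_trans _); apply.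
  rewrite -{1}(subnK nm) (le_trans (dist _ _)) // lerDl exprn_ge0 //.
  by rewrite invr_ge0.
have [l ly] : exists l : V, y @ \oo --> l by exists (lim (y @ \oo)).
exists l => n; apply/ler_addgt0Pr => e e0.
move/cvgrPdist_le: ly => /(_ _ e0) [N _ hN].
rewrite -(subrKA (y (N + n)%N)) (le_trans (ler_normD _ _)) // addrC lerD //.
by apply: hN => /=; rewrite leq_addr.
Qed.

(** * Adjoints *)

Lemma dot_eq0 (R : realType) (H : hilbertType R) (x : H) :
  hdot H x x = 0 -> x = 0.
Proof. by rewrite -hdot_norm => /eqP; rewrite sqrf_eq0 normr_eq0 => /eqP. Qed.

Lemma is_adjoint_sym (R : realType) (H : hilbertType R) (T T' : H -> H) :
  is_adjoint T T' -> is_adjoint T' T.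
Proof.
by move=> h x y; rewrite [LHS]hermC [RHS]hermC /= h.
Qed.

Lemma is_adjoint_unique (R : realType) (H : hilbertType R) (T T1 T2 : H -> H) :
  is_adjoint T T1 -> is_adjoint T T2 -> T1 = T2.
Proof.
move=> h1 h2; apply/funext => x; apply/eqP; rewrite -subr_eq0; apply/eqP.
by apply: dot_eq0; rewrite linearBr /= -h1 -h2 subrr.
Qed.

Lemma adjE (R : realType) (H : hilbertType R) (T T' : H -> H) :
  is_adjoint T T' -> adj T = T'.
Proof. by move=> h; apply: xget_unique => // S /is_adjoint_unique; apply. Qed.

Lemma is_adjoint_comp (R : realType) (H : hilbertType R)
    (S S' T T' : H -> H) :
  is_adjoint S S' -> is_adjoint T T' -> is_adjoint (S \o T) (T' \o S').
Proof. by move=> hS hT x y /=; rewrite hS hT. Qed.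

Lemma is_adjoint_add (R : realType) (H : hilbertType R) (S S' T T' : H -> H) :
  is_adjoint S S' -> is_adjoint T T' -> is_adjoint (S \+ T) (S' \+ T').
Proof. by move=> hS hT x y /=; rewrite linearDl linearDr /= hS hT. Qed.

Lemma is_adjoint_scale (R : realType) (H : hilbertType R) (c : R[i])
    (T T' : H -> H) :
  is_adjoint T T' -> is_adjoint (fun x => c *: T x) (fun x => c^* *: T' x).
Proof.
by move=> hT x y; rewrite linearZl_LR linearZr_LR /= hT /= conjCK.
Qed.

Lemma is_adjoint_id (R : realType) (H : hilbertType R) :
  is_adjoint (idfun : H -> H) idfun.
Proof. by []. Qed.

Lemma is_adjoint_iter (R : realType) (H : hilbertType R) (n : nat)
    (T T' : H -> H) :
  is_adjoint T T' -> is_adjoint (iter n T) (iter n T').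
Proof.
by move=> hT; elim: n => [//|n IH] x y; rewrite iterSr iterS IH hT.
Qed.

(* Expanding [|T (T' x) - M^2 x|^2 >= 0] bounds T' without Cauchy-Schwarz. *)
Lemma adjoint_bound (R : realType) (H : hilbertType R) (T T' : H -> H)
    (M : R[i]) :
  0 < M -> is_adjoint T T' -> (forall x, `|T x| <= M * `|x|) ->
  forall x, `|T' x| <= M * `|x|.
Proof.
move=> M0 hT bT x.
have Mr : (M ^+ 2)^* = M ^+ 2 by apply: CrealP; rewrite rpredX // gtr0_real.
have E : hdot H (T (T' x)) x = `|T' x| ^+ 2 by rewrite hT hdot_norm.
have := dnorm_ge0 (hdot H) (T (T' x) - M ^+ 2 *: x).
rewrite dnormB -!hdot_norm normrZ linearZr_LR /= E Mr.
rewrite (CrealP _) ?rpredM ?rpredX ?normr_real ?gtr0_real // => h.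
have b2 : `|T (T' x)| ^+ 2 <= M ^+ 2 * `|T' x| ^+ 2.
  by rewrite -exprMn lerXn2r ?nnegrE ?mulr_ge0 // ltW.
rewrite -(@ler_pXn2r _ 2) ?nnegrE ?mulr_ge0 ?(ltW M0) //.
(* The expansion and [b2] give 0 <= M^2 (M^2 |x|^2 - |T' x|^2); the positive factor M^2 is
   cancelled. *)
rewrite -subr_ge0 -(pmulr_rge0 _ (exprn_gt0 2 M0)).
apply: le_trans (le_trans h (lerD (lerD b2 (lexx _)) (lexx _))) _.
by rewrite gtr0_norm ?exprn_gt0 // le_eqVlt; apply/orP; left; apply/eqP; ring.
Qed.

Lemma is_adjoint_sub (R : realType) (H : hilbertType R) (S S' T T' : H -> H) :
  is_adjoint S S' -> is_adjoint T T' ->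
  is_adjoint (fun x => S x - T x) (fun x => S' x - T' x).
Proof. by move=> hS hT x y; rewrite linearBl linearBr /= hS hT. Qed.

(** * Operations in a C*-algebra and the square root of 1 - X *)

Lemma bounded_opB (R : realType) (H : hilbertType R) (T : H -> H) :
  bounded_op T -> forall x y, T (x - y) = T x - T y.
Proof.
by move=> [linT _] x y; rewrite -scaleN1r addrC linT scaleN1r addrC.
Qed.

Lemma cstar_sub (R : realType) (H : hilbertType R) (A : set (H -> H))
    (S T : H -> H) :
  unital_cstar A -> A S -> A T -> A (fun x => S x - T x).
Proof.
move=> hA AS AT.
have -> : (fun x => S x - T x) = S \+ (fun x => -1 *: T x).
  by apply/funext => x /=; rewrite scaleN1r.
by apply: cstar_add => //; apply: cstar_scale.
Qed.

Lemma cstar_is_adjoint (R : realType) (H : hilbertType R) (A : set (H -> H))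
    (T : H -> H) :
  unital_cstar A -> A T -> is_adjoint T (adj T).
Proof. by move=> hA /(cstar_adj hA) [T' _ hT']; rewrite (adjE hT'). Qed.

Lemma cstar_adjoint (R : realType) (H : hilbertType R) (A : set (H -> H))
    (T : H -> H) :
  unital_cstar A -> A T -> A (adj T).
Proof. by move=> hA /(cstar_adj hA) [T' AT' hT']; rewrite (adjE hT'). Qed.

Lemma cstar_iter (R : realType) (H : hilbertType R) (A : set (H -> H))
    (T : H -> H) (n : nat) :
  unital_cstar A -> A T -> A (iter n T).
Proof.
move=> hA AT; elim: n => [|n IH]; first exact: (cstar_unit hA).
exact: (cstar_mul hA AT IH).
Qed.

(* [1 - X = (1 - Y)^2], where Y is the fixed point of the map
   [Z |-> (X + Z^2) / 2], a contraction of the ball of radius [1/2]. *)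
Lemma cstar_sqrt_1sub (R : realType) (H : hilbertType R) (A : set (H -> H))
    (X : H -> H) :
  unital_cstar A -> A X -> is_adjoint X X ->
  (forall x, `|X x| <= 4^-1 * `|x|) ->
  exists B : H -> H,
    [/\ A B, is_adjoint B B & B \o B = (fun x => x - X x)].
Proof.
move=> hA AX hX bX.
have [Y [Y0 YE]] : exists Y : nat -> H -> H,
    Y 0%N = X /\ forall n, Y n.+1 = (fun x => 2^-1 *: (X \+ (Y n \o Y n)) x).
  by exists (fun n => iter n (fun Z x => 2^-1 *: (X \+ (Z \o Z)) x) X).
have YS n x : Y n.+1 x = 2^-1 *: (X x + Y n (Y n x)) by rewrite YE.
have hh : 2^-1 + 2^-1 = 1 :> R[i] by field.
have h4 : 4^-1 + 2^-1 * 2^-1 = 2^-1 :> R[i] by field.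
have h0 : 0 <= 2^-1 :> R[i] by rewrite invr_ge0.
have hn0 n : 0 <= 2^-1 ^+ n :> R[i] by rewrite exprn_ge0.
have AY n : A (Y n).
  elim: n => [|n IH]; rewrite ?Y0 // YE.
  by apply: (cstar_scale hA); apply: cstar_add => //; apply: cstar_mul.
have bdY n : bounded_op (Y n) := cstar_bounded hA (AY n).
have adY n : is_adjoint (Y n) (Y n).
  elim: n => [|n IH]; rewrite ?Y0 // YE.
  have := is_adjoint_scale 2^-1 (is_adjoint_add hX (is_adjoint_comp IH IH)).
  by rewrite (CrealP _) // rpredV realn.
have bY n x : `|Y n x| <= 2^-1 * `|x|.
  elim: n x => [|n IH] x.
    by rewrite Y0 (le_trans (bX x)) // ler_wpM2r // lef_pV2 ?posrE // ler_nat.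
  rewrite YS normrZ ger0_norm // ler_wpM2l //.
  rewrite (le_trans (ler_normD _ _)) //.
  have := le_trans (IH (Y n x)) (ler_wpM2l h0 (IH x)).
  move=> /(lerD (bX x)) /le_trans; apply.
  by rewrite mulrA -mulrDl ler_piMl // h4 invf_le1 // ler1n.
have dY n x : `|Y n.+1 x - Y n x| <= 2^-1 ^+ n * `|x|.
  elim: n x => [|n IH] x.
    rewrite mul1r (le_trans (ler_normB _ _)) // (le_trans (lerD (bY _ _) (bY _ _))) //.
    by rewrite -mulrDl -[leRHS]mul1r ler_wpM2r // hh.
  rewrite (YS n.+1) [X in _ - X]YS -scalerBr opprD addrACA subrr add0r.
  (* Y'^2 - Y^2 = Y' (Y' - Y) + (Y' - Y) Y for Y' = [Y n.+1] and Y = [Y n]; each summand has half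
     the bound on Y' - Y, so the outer factor 1/2 remains. *)
  rewrite -(subrKA (Y n.+1 (Y n x))) -bounded_opB //.
  rewrite normrZ ger0_norm // exprS -mulrA ler_wpM2l //.
  rewrite (le_trans (ler_normD _ _)) //.
  have := le_trans (bY n.+1 (Y n.+1 x - Y n x)) (ler_wpM2l h0 (IH x)).
  move=> /lerD /(_ (le_trans (IH (Y n x)) (ler_wpM2l (hn0 n) (bY n x)))) /le_trans.
  apply; rewrite le_eqVlt; apply/orP; left; apply/eqP.
  by rewrite mulrCA -mulrDr -mulrDl hh mul1r.
have [Z hZ] : exists Z : H -> H, forall x n,
    `|Z x - Y n x| <= 2^-1 ^+ n * 2 * `|x|.
  suff /choice [Z hZ] : forall x, exists z, forall n,
      `|z - Y n x| <= 2^-1 ^+ n * 2 * `|x| by exists Z.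
  move=> x; have [//|z hz] := @geometric_cvg _ _ (Y ^~ x) `|x| _ (dY ^~ x).
  by exists z => n; rewrite -mulrA.
(* The rate is uniform in x, so [Z] is a norm limit and lies in [A], from which its linearity and
   its adjoint come. *)
have AZ : A Z.
  apply: (cstar_closed hA) => e e0.
  have [n hn] := @complex_half_expn R (e / 2) (divr_gt0 e0 (ltr0Sn _ _)).
  exists (Y n) => // x; rewrite (le_trans (hZ x n)) // ler_wpM2r //.
  by rewrite -ler_pdivlMr // ltW.
have bdZ := cstar_bounded hA AZ.
have adZ : is_adjoint Z Z.
  have [Z' _ hZ'] := cstar_adj hA AZ.
  suff ZZ : Z' = Z by rewrite -{2}ZZ.
  apply/funext => x; apply/eqP; rewrite -subr_eq0; apply/eqP.
  apply: (@le0_of_half_expn _ _ _ (4 * `|x|)); first by rewrite mulr_ge0.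
  (* Taking adjoints preserves the bound on [Z - Y n], so [Z'] is the limit of the same self-adjoint
     [Y n]. *)
  move=> n; have := @adjoint_bound _ _ _ _ (2^-1 ^+ n * 2) _ (is_adjoint_sub hZ' (adY n)).
  have -> : 0 < 2^-1 ^+ n * 2 :> R[i] by rewrite mulr_gt0 // exprn_gt0 // invr_gt0.
  move=> /(_ isT) bZ'.
  have {}bZ' := bZ' (hZ ^~ n) x.
  rewrite -(subrKA (Y n x)) (le_trans (ler_normD _ _)) //.
  rewrite (distrC (Y n x)) (le_trans (lerD bZ' (hZ x n))) //.
  by rewrite le_eqVlt; apply/orP; left; apply/eqP; ring.
have fixZ x : 2 *: Z x = X x + Z (Z x).
  suff /eqP : Z x - 2^-1 *: (X x + Z (Z x)) = 0.
    rewrite subr_eq0 => /eqP {1}->.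
    by rewrite scalerA divff ?scale1r // pnatr_eq0.
  (* The first summand bounds the distance from [Z x] to [Y n.+1 x], the other two half the distance
     from Y_n^2 x to Z^2 x, split at [Y n (Z x)]. *)
  apply: (@le0_of_half_expn _ _ _ (`|x| + (2^-1 * `|x| + `|Z x|))).
    by rewrite !addr_ge0 // mulr_ge0.
  move=> n; rewrite -(subrKA (Y n.+1 x)) (le_trans (ler_normD _ _)) // mulrDr.
  rewrite lerD //.
    by rewrite (le_trans (hZ x n.+1)) // exprSr mulfVK ?pnatr_eq0.
  rewrite YS -scalerBr opprD addrACA subrr add0r.
  rewrite -(subrKA (Y n (Z x))) -bounded_opB // normrZ ger0_norm //.
  have bYZ : `|Y n (Y n x - Z x)| <= 2^-1 * (2^-1 ^+ n * 2 * `|x|).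
    by rewrite (le_trans (bY _ _)) // ler_wpM2l // distrC.
  have := lerD bYZ (hZ (Z x) n); rewrite (distrC (Z _)).
  move=> /(le_trans (ler_normD _ _)) /(ler_wpM2l h0) /le_trans; apply.
  by rewrite le_eqVlt; apply/orP; left; apply/eqP; field.
exists (fun x => x - Z x); split.
- exact: (cstar_sub hA (cstar_unit hA) AZ).
- exact: (is_adjoint_sub (@is_adjoint_id _ _) adZ).
- apply/funext => x /=; rewrite bounded_opB // opprB.
  have -> : X x = 2 *: Z x - Z (Z x) by rewrite fixZ addrK.
  by rewrite scaler_nat mulr2n opprB opprD !addrA (addrAC x).
Qed.

(** * Continuity of *-homomorphisms *)

Lemma star_hom_sub (R : realType) (H K : hilbertType R) (A : set (H -> H))
    (B : set (K -> K)) (f : (H -> H) -> (K -> K)) (S T : H -> H) :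
  unital_cstar A -> star_hom A B f -> A S -> A T ->
  f (fun x => S x - T x) = (fun y => f S y - f T y).
Proof.
move=> hA hf AS AT.
have -> : (fun x => S x - T x) = S \+ (fun x => -1 *: T x).
  by apply/funext => x /=; rewrite scaleN1r.
rewrite (shom_add hf) ?(shom_scale hf) //; last exact: cstar_scale.
by apply/funext => y /=; rewrite scaleN1r.
Qed.

(** The factor 2 leaves room: [T1] has norm at most 1/2, which makes [1 - adj T1 \o T1] a square
    [C \o C] inside [A], and the image of this square under [f] is positive. *)
Lemma star_hom_bounded (R : realType) (H K : hilbertType R) (A : set (H -> H))
    (B : set (K -> K)) (f : (H -> H) -> (K -> K)) (T : H -> H) (e : R[i]) :
  unital_cstar A -> star_hom A B f -> A T -> 0 < e ->
  (forall x, `|T x| <= e * `|x|) -> forall y, `|f T y| <= 2 * e * `|y|.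
Proof.
move=> hA hf AT e0 bT y.
have e2 : 0 < 2 * e by rewrite mulr_gt0.
pose T1 := fun x => (2 * e)^-1 *: T x.
have AT1 : A T1 by exact: cstar_scale.
have bT1 x : `|T1 x| <= 2^-1 * `|x|.
  rewrite normrZ gtr0_norm ?invr_gt0 // ler_pdivrMl // mulrA.
  by rewrite (mulrAC 2) divff ?mul1r // pnatr_eq0.
have ad1 := cstar_is_adjoint hA AT1.
have A1 := cstar_adjoint hA AT1.
have AX : A (adj T1 \o T1) by exact: cstar_mul.
have bX x : `|(adj T1 \o T1) x| <= 4^-1 * `|x|.
  have h2 : 0 < 2^-1 :> R[i] by rewrite invr_gt0.
  rewrite (le_trans (adjoint_bound h2 ad1 bT1 _)) //.
  rewrite (le_trans (ler_wpM2l (ltW h2) (bT1 x))) // mulrA ler_wpM2r //.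
  by rewrite le_eqVlt; apply/orP; left; apply/eqP; field.
have [C [AC adC CC]] := cstar_sqrt_1sub hA AX
  (is_adjoint_comp (is_adjoint_sym ad1) ad1) bX.
have fCC : f C \o f C = (fun y => y - f (adj T1) (f T1 y)).
  rewrite -(shom_mul hf) // CC (star_hom_sub hA hf (cstar_unit hA) AX).
  by rewrite (shom_unit hf) (shom_mul hf).
have fadC : is_adjoint (f C) (f C).
  by have := shom_adj hf AC; rewrite (adjE adC).
(* The difference of squares is the inner product of y with (1 - f(T1)^* f(T1)) y = f(C)^2 y, that
   is |f(C) y|^2. *)
have : `|f T1 y| ^+ 2 <= `|y| ^+ 2.
  rewrite -subr_ge0 !hdot_norm (shom_adj hf AT1) -linearBr /=.
  rewrite -[_ - _]/((fun y => y - f (adj T1) (f T1 y)) y) -fCC /= -fadC.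
  exact: dnorm_ge0.
rewrite ler_pXn2r ?nnegrE // /T1 (shom_scale hf) // normrZ.
by rewrite gtr0_norm ?invr_gt0 // ler_pdivrMl.
Qed.

(** * Generated C*-algebras *)

Lemma gen_cstar_sub (R : realType) (H : hilbertType R) (A G : set (H -> H)) :
  unital_cstar A -> G `<=` A -> gen_cstar G `<=` A.
Proof. by move=> hA GA T; apply. Qed.

Lemma sub_gen_cstar (R : realType) (H : hilbertType R) (G : set (H -> H)) :
  G `<=` gen_cstar G.
Proof. by move=> T GT A _; apply. Qed.

(* The hypothesis guarantees that [gen_cstar G] is not the intersection of an
   empty family. *)
Lemma unital_gen_cstar (R : realType) (H : hilbertType R)
    (A G : set (H -> H)) :
  unital_cstar A -> G `<=` A -> unital_cstar (gen_cstar G).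
Proof.
move=> hA GA; split.
- by move=> T /(gen_cstar_sub hA GA); apply: cstar_bounded.
- by move=> B hB _; apply: (cstar_unit hB).
- by move=> S T gS gT B hB GB; exact: (cstar_add hB (gS _ hB GB) (gT _ hB GB)).
- by move=> c T gT B hB GB; exact: (cstar_scale hB c (gT _ hB GB)).
- by move=> S T gS gT B hB GB; exact: (cstar_mul hB (gS _ hB GB) (gT _ hB GB)).
- move=> T gT; exists (adj T); last first.
    exact: (cstar_is_adjoint hA (gT _ hA GA)).
  by move=> B hB GB; exact: (cstar_adjoint hB (gT _ hB GB)).
- move=> T hT B hB GB; apply: (cstar_closed hB) => e /hT [S gS bS].
  by exists S => //; apply: gS.
Qed.

(** * Constructions with *-homomorphisms *)

Lemma star_hom_adj (R : realType) (H K : hilbertType R) (A : set (H -> H))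
    (B : set (K -> K)) (f : (H -> H) -> (K -> K)) (T : H -> H) :
  star_hom A B f -> A T -> f (adj T) = adj (f T).
Proof. by move=> hf AT; rewrite (adjE (shom_adj hf AT)). Qed.

Lemma star_hom_codom (R : realType) (H K : hilbertType R) (A : set (H -> H))
    (B B' : set (K -> K)) (f : (H -> H) -> (K -> K)) :
  (forall T, A T -> B' (f T)) -> star_hom A B f -> star_hom A B' f.
Proof. by move=> hB' [*]; split. Qed.

Lemma star_hom_dom (R : realType) (H K : hilbertType R) (A A' : set (H -> H))
    (B : set (K -> K)) (f : (H -> H) -> (K -> K)) :
  A' `<=` A -> star_hom A B f -> star_hom A' B f.
Proof. by move=> sA [h1 h2 h3 h4 h5 h6]; split; auto. Qed.

Lemma star_hom_comp (R : realType) (H K L : hilbertType R) (A : set (H -> H))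
    (B : set (K -> K)) (C : set (L -> L)) (f : (H -> H) -> (K -> K))
    (g : (K -> K) -> (L -> L)) :
  star_hom A B f -> star_hom B C g -> star_hom A C (g \o f).
Proof.
move=> hf hg; split => /=.
- by move=> T /(shom_codom hf); apply: (shom_codom hg).
- by rewrite (shom_unit hf) (shom_unit hg).
- move=> S T AS AT; rewrite (shom_add hf AS AT).
  exact: (shom_add hg (shom_codom hf AS) (shom_codom hf AT)).
- move=> c T AT; rewrite (shom_scale hf c AT).
  exact: (shom_scale hg c (shom_codom hf AT)).
- move=> S T AS AT; rewrite (shom_mul hf AS AT).
  exact: (shom_mul hg (shom_codom hf AS) (shom_codom hf AT)).
- by move=> T AT; rewrite (star_hom_adj hf AT); apply: (shom_adj hg);
     apply: (shom_codom hf).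
Qed.

Lemma star_hom_id (R : realType) (H : hilbertType R) (A B : set (H -> H)) :
  unital_cstar A -> A `<=` B -> star_hom A B id.
Proof. by move=> hA AB; split => // T AT; apply: cstar_is_adjoint hA AT. Qed.

(** * From generators to the whole algebra *)

(** The algebraic clauses are formal; norm-closedness is where continuity of [f] and [g] enters. *)
Lemma equalizer_cstar (R : realType) (H K : hilbertType R) (A : set (H -> H))
    (B B' : set (K -> K)) (f g : (H -> H) -> (K -> K)) :
  unital_cstar A -> star_hom A B f -> star_hom A B' g ->
  unital_cstar [set T | A T /\ f T = g T].
Proof.
move=> hA hf hg; split.
- by move=> T [AT _]; apply: (cstar_bounded hA).
- by split; [apply: (cstar_unit hA)|rewrite (shom_unit hf) (shom_unit hg)].
- move=> S T [AS eS] [AT eT]; split; first exact: cstar_add.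
  by rewrite (shom_add hf) // (shom_add hg) // eS eT.
- move=> c T [AT eT]; split; first exact: cstar_scale.
  by rewrite (shom_scale hf) // (shom_scale hg) // eT.
- move=> S T [AS eS] [AT eT]; split; first exact: cstar_mul.
  by rewrite (shom_mul hf) // (shom_mul hg) // eS eT.
- move=> T [AT eT]; exists (adj T); last exact: cstar_is_adjoint hA AT.
  split; first exact: cstar_adjoint.
  by rewrite (star_hom_adj hf) // (star_hom_adj hg) // eT.
- move=> T hT; have AT : A T.
    by apply: (cstar_closed hA) => e /hT [S [AS _] bS]; exists S.
  split=> //; apply/funext => y; apply/eqP; rewrite -subr_eq0; apply/eqP.
  (* 4 = 2 + 2: each of [f] and [g] at most doubles the distance to an approximant [S] with
     [f S = g S]. *)
  apply: (@le0_of_half_expn _ _ _ (4 * `|y|)); first by rewrite mulr_ge0.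
  move=> n; have e0 : 0 < 2^-1 ^+ n :> R[i] by rewrite exprn_gt0 // invr_gt0.
  have [S [AS eS] bS] := hT _ e0.
  have AD := cstar_sub hA AT AS.
  have := star_hom_bounded hA hf AD e0 bS y.
  rewrite (star_hom_sub hA hf) // eS => bf.
  have := star_hom_bounded hA hg AD e0 bS y.
  rewrite (star_hom_sub hA hg) // => bg.
  rewrite -(subrKA (g S y)) (le_trans (ler_normD _ _)) // (distrC (g S y)).
  rewrite (le_trans (lerD bf bg)) //.
  by rewrite le_eqVlt; apply/orP; left; apply/eqP; ring.
Qed.

(** As for the equalizer, continuity gives closedness. The purpose is to shrink a codomain such as
    all bounded operators. *)
Lemma preimage_cstar (R : realType) (H K : hilbertType R) (A : set (H -> H))
    (B B' : set (K -> K)) (f : (H -> H) -> (K -> K)) :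
  unital_cstar A -> unital_cstar B -> star_hom A B' f ->
  unital_cstar [set T | A T /\ B (f T)].
Proof.
move=> hA hB hf; split.
- by move=> T [AT _]; apply: (cstar_bounded hA).
- by split; [apply: (cstar_unit hA)|rewrite (shom_unit hf); apply: cstar_unit hB].
- move=> S T [AS BS] [AT BT]; split; first exact: cstar_add.
  by rewrite (shom_add hf) //; apply: cstar_add.
- move=> c T [AT BT]; split; first exact: cstar_scale.
  by rewrite (shom_scale hf) //; apply: cstar_scale.
- move=> S T [AS BS] [AT BT]; split; first exact: cstar_mul.
  by rewrite (shom_mul hf) //; apply: cstar_mul.
- move=> T [AT BT]; exists (adj T); last exact: cstar_is_adjoint hA AT.
  split; first exact: cstar_adjoint.
  by rewrite (star_hom_adj hf) //; apply: cstar_adjoint.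
- move=> T hT; have AT : A T.
    by apply: (cstar_closed hA) => e /hT [S [AS _] bS]; exists S.
  split=> //; apply: (cstar_closed hB) => e e0.
  (* Half of e compensates for the factor 2 in [star_hom_bounded]. *)
  have e2 : 0 < e / 2 by rewrite divr_gt0.
  have [S [AS BS] bS] := hT _ e2; exists (f S) => // y.
  have := star_hom_bounded hA hf (cstar_sub hA AT AS) e2 bS y.
  by rewrite (star_hom_sub hA hf) // mulrCA divff ?mulr1 // pnatr_eq0.
Qed.

(** The equalizer is a unital C*-algebra containing [G], so it contains the algebra that [G]
    generates. *)
Lemma eq_star_hom_gen (R : realType) (H K : hilbertType R)
    (A G : set (H -> H)) (B B' : set (K -> K)) (f g : (H -> H) -> (K -> K)) :
  unital_cstar A -> A = gen_cstar G -> star_hom A B f -> star_hom A B' g ->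
  (forall T, G T -> f T = g T) -> forall T, A T -> f T = g T.
Proof.
move=> hA AG hf hg fg T; rewrite {1}AG => gT.
have [|_ //] := gT _ (equalizer_cstar hA hf hg).
by move=> S GS; split; [rewrite AG; apply: sub_gen_cstar|apply: fg].
Qed.

(** The preimage of [B] contains [G], hence all of [A]. This places the values of the representation
    supplied by the crossed product inside [Q]. *)
Lemma star_hom_gen_codom (R : realType) (H K : hilbertType R)
    (A G : set (H -> H)) (B B' : set (K -> K)) (f : (H -> H) -> (K -> K)) :
  unital_cstar A -> A = gen_cstar G -> unital_cstar B -> star_hom A B' f ->
  (forall T, G T -> B (f T)) -> star_hom A B f.
Proof.
move=> hA AG hB hf fB; apply: (star_hom_codom _ hf) => T; rewrite {1}AG => gT.
have [|_ //] := gT _ (preimage_cstar hA hB hf).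
by move=> S GS; split; [rewrite AG; apply: sub_gen_cstar|apply: fB].
Qed.

(** * Isometries *)

Lemma isometry_of_adjoint (R : realType) (H : hilbertType R)
    (T T' : H -> H) :
  is_adjoint T T' -> cancel T T' -> forall x, `|T x| = `|x|.
Proof.
move=> hT TK x; apply/eqP; rewrite -(@eqrXn2 _ 2) //.
by rewrite !hdot_norm hT TK.
Qed.

(* [|T' (T x) - x|^2 = |T' (T x)|^2 - |x|^2 <= 0], which spares a polarization
   argument. *)
Lemma isometry_adjointK (R : realType) (H : hilbertType R) (T T' : H -> H) :
  is_adjoint T T' -> (forall x, `|T x| = `|x|) -> cancel T T'.
Proof.
move=> hT iT x; apply/eqP; rewrite -subr_eq0 -normr_eq0 -sqrf_eq0.
rewrite eq_le exprn_ge0 // andbT.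
have E : hdot H (T' (T x)) x = `|x| ^+ 2.
  by rewrite (is_adjoint_sym hT) -hdot_norm iT.
have bT' : `|T' (T x)| <= `|x|.
  rewrite -(iT x) -[leRHS]mul1r; apply: (adjoint_bound _ hT) => // y.
  by rewrite mul1r iT.
rewrite hdot_norm dnormB E -!hdot_norm (CrealP _) ?rpredX ?normr_real //.
rewrite opprD addrA addrK subr_le0.
by rewrite ler_pXn2r ?nnegrE.
Qed.

(** * Iterates, integer powers and the monomials u^l s^i *)

Lemma star_hom_iter (R : realType) (H K : hilbertType R) (A : set (H -> H))
    (B : set (K -> K)) (f : (H -> H) -> (K -> K)) (T : H -> H) (n : nat) :
  unital_cstar A -> star_hom A B f -> A T -> f (iter n T) = iter n (f T).
Proof.
move=> hA hf AT; elim: n => [|n IH]; first exact: (shom_unit hf).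
have -> : iter n.+1 T = T \o iter n T by [].
by rewrite (shom_mul hf) // ?IH //; apply: cstar_iter.
Qed.

(** An induction that ignores the two constructors of [int]; in its uses below the downward step
    cancels an injective operator. *)
Lemma int_shift_ind (P : int -> Prop) :
  P 0 -> (forall l, P l -> P (l + 1)) -> (forall l, P (l + 1) -> P l) ->
  forall l, P l.
Proof.
move=> P0 Pup Pdown; elim/int_ind => // n Pn.
  have -> : n.+1 = n%:Z + 1 :> int by lia.
  exact: Pup.
apply: Pdown; have -> : - n.+1%:Z + 1 = - n%:Z by lia.
exact: Pn.
Qed.

Lemma upowS (R : realType) (H : hilbertType R) (u : H -> H) (l : int) (x : H) :
  cancel (adj u) u -> upow u (l + 1) x = u (upow u l x).
Proof.
move=> uVK; case: l => [n|[|n]].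
- have -> : Posz n + 1 = n.+1 :> int by lia.
  by [].
- by rewrite /= uVK.
- have -> : Negz n.+1 + 1 = Negz n by lia.
  by rewrite [in RHS]/upow iterS uVK.
Qed.

Lemma upowD (R : realType) (H : hilbertType R) (u : H -> H) (l m : int)
    (x : H) :
  cancel u (adj u) -> cancel (adj u) u ->
  upow u (l + m) x = upow u l (upow u m x).
Proof.
move=> uK uVK; elim/int_shift_ind: l => [|l IH|l IH].
- by rewrite add0r.
- by rewrite addrAC !upowS // IH.
- by apply: (can_inj uK); rewrite -!upowS // addrAC.
Qed.

(** Moving [s] past a power of [u] doubles the exponent, so i factors multiply it by 2^i. *)
Lemma iter_upow (R : realType) (H : hilbertType R) (u s : H -> H) (i : nat)
    (l : int) (x : H) :
  cancel u (adj u) -> cancel (adj u) u -> s \o u = u \o u \o s ->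
  iter i s (upow u l x) = upow u ((2 ^ i)%N%:Z * l) (iter i s x).
Proof.
move=> uK uVK su.
have comm y : s (u y) = u (u (s y)) := congr1 (@^~ y) su.
have comm_upow k y : s (upow u k y) = upow u (2 * k) (s y).
  have E j : 2 * (j + 1) = 2 * j + 1 + 1 :> int by lia.
  elim/int_shift_ind: k => [//|k IH|k]; rewrite E !upowS // comm ?IH //.
  by move=> /(can_inj uK)/(can_inj uK).
elim: i => [|i IH]; first by rewrite mul1r.
by rewrite !iterS IH comm_upow; congr upow; rewrite expnS PoszM mulrA.
Qed.

(** The indices follow the product of [Zpow2]: this is the homomorphism law for the covariant pair
    on [H]. *)
Lemma monomialM (R : realType) (H : hilbertType R) (u s : H -> H)
    (l m : int) (i j : nat) :
  cancel u (adj u) -> cancel (adj u) u -> s \o u = u \o u \o s ->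
  monomial u s (l + (2 ^ i)%N%:Z * m) (i + j) =
  monomial u s l i \o monomial u s m j.
Proof.
move=> uK uVK su; apply/funext => x; rewrite /monomial /=.
by rewrite upowD // iterD iter_upow.
Qed.

Lemma is_adjoint_upow (R : realType) (H : hilbertType R) (u : H -> H)
    (l : int) :
  is_adjoint u (adj u) -> is_adjoint (upow u l) (upow u (- l)).
Proof.
(* Zero is set apart: [- Posz n.+1] is [Negz n], whereas [- 0] is again a [Posz]. *)
move=> hu; case: l => [[|n]|n]; first exact: is_adjoint_id.
  exact: (@is_adjoint_iter _ _ n.+1 _ _ hu).
exact: (@is_adjoint_iter _ _ n.+1 _ _ (is_adjoint_sym hu)).
Qed.

Lemma adj_monomial (R : realType) (H : hilbertType R) (A : set (H -> H))
    (u s : H -> H) (l : int) (i : nat) :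
  unital_cstar A -> A u -> A s ->
  adj (monomial u s l i) = adj (iter i s) \o upow u (- l).
Proof.
move=> hA Au As; apply: adjE; apply: is_adjoint_comp.
  exact: is_adjoint_upow (cstar_is_adjoint hA Au).
exact: cstar_is_adjoint hA (cstar_iter i hA As).
Qed.

Lemma cstar_monomial (R : realType) (H : hilbertType R) (A : set (H -> H))
    (u s : H -> H) (l : int) (i : nat) :
  unital_cstar A -> A u -> A s -> A (monomial u s l i).
Proof.
move=> hA Au As; apply: (cstar_mul hA); last exact: cstar_iter.
case: l => n; first exact: cstar_iter.
by apply: cstar_iter => //; apply: cstar_adjoint.
Qed.

(** * The isomorphism and its inverse *)

Theorem proposition5p1 (R : realType) (H L : hilbertType R)
    (Q : set (H -> H)) (u s : H -> H)
    (A : set (L -> L)) (iota : (H -> H) -> (L -> L)) (w : Zpow2 -> L -> L) :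
  is_Q2 Q u s ->
  is_crossed_product (Dalg u s) (alphaD u s) A iota w ->
  exists phi : (H -> H) -> (L -> L),
    [/\ star_iso Q A phi,
        forall (l : int) (i : nat), phi (monomial u s l i) = w (ZPow2 l i)
      & forall psi : (H -> H) -> (L -> L), star_hom Q A psi ->
          (forall (l : int) (i : nat), psi (monomial u s l i) = w (ZPow2 l i)) ->
          forall T, Q T -> psi T = phi T].
Proof.
move=> hQ2 hcp.
have hQ := Q2_cstar hQ2; have QE := Q2_generated hQ2.
have [uVu uuV sVs su usum] := Q2_rel hQ2.
have uK : cancel u (adj u) by move=> x; apply: (congr1 (@^~ x) uVu).
have uVK : cancel (adj u) u by move=> x; apply: (congr1 (@^~ x) uuV).
have sK : cancel s (adj s) by move=> x; apply: (congr1 (@^~ x) sVs).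
have Qu : Q u by rewrite QE; apply: sub_gen_cstar; left.
have Qs : Q s by rewrite QE; apply: sub_gen_cstar; right.
have Qmono l i : Q (monomial u s l i) by exact: cstar_monomial.
have adu := cstar_is_adjoint hQ Qu; have ads := cstar_is_adjoint hQ Qs.
(* [e l i] is alpha_q(1) for q = (l, 2^i), which is a generator of [D]; in this form covariance
   applies to it. *)
pose D := Dalg u s; pose e l i : H -> H := alphaD u s (ZPow2 l i) idfun.
have eE l i : e l i =
    upow u l \o (iter i s \o adj (iter i s)) \o upow u (- l).
  by rewrite /e /alphaD /= (adj_monomial _ _ hQ).
have De l i : D (e l i).
  by apply: sub_gen_cstar; exists l, i; apply: eE.
have genQ : [set T | exists (l : int) (i : nat),
    T = upow u l \o (iter i s \o adj (iter i s)) \o upow u (- l)] `<=` Q.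
  move=> _ [l [i ->]]; rewrite -eE.
  exact: (cstar_mul hQ (Qmono l i) (cstar_adjoint hQ (Qmono l i))).
have DQ : D `<=` Q := gen_cstar_sub hQ genQ.
have hD : unital_cstar D := unital_gen_cstar hQ genQ.
have hA := cp_cstar hcp; have AE := cp_generated hcp.
have [hiota linw isow w1 wM wcov] := cp_covariant hcp.
have Aw q : A (w q) by rewrite AE; apply: sub_gen_cstar; right; exists q.
have Aiota a : D a -> A (iota a).
  by move=> Da; rewrite AE; apply: sub_gen_cstar; left; exists a.
have adw q := cstar_is_adjoint hA (Aw q).
have wK q : cancel (w q) (adj (w q)) := isometry_adjointK (adw q) (isow q).
(* Covariance at the unit: [w q] has range projection iota(alpha_q(1)). *)
have iota_e l i : iota (e l i) = w (ZPow2 l i) \o adj (w (ZPow2 l i)).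
  by rewrite wcov ?(shom_unit hiota) //; apply: cstar_unit hD.
pose U := w (ZPow2 1 0); pose S := w (ZPow2 0 1).
(* In the semigroup (1, 1)(-1, 1) = (0, 1), so the isometry [U] is onto, hence unitary. *)
have UV x : U (w (ZPow2 (- 1) 0) x) = x.
  by rewrite -[LHS]/((w _ \o w _) x) -wM -[RHS]/(idfun x) -w1.
have adjU : adj U = w (ZPow2 (- 1) 0).
  by apply/funext => x; rewrite -[in LHS](UV x) wK.
have USE : w (ZPow2 1 1) = U \o S by rewrite -wM.
have relA : Q2_relations U S.
  split; try by apply/funext => x; exact: wK.
  - by apply/funext => x; rewrite adjU /= UV.
  - by rewrite -!wM.
  (* The last relation in [Q] says that [e 0 1] and [e 1 1] sum to 1; additivity of [iota] transfers
     it to [U] and [S]. *)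
  - have <- : iota (e 0 1%N \+ e 1 1%N) = idfun.
      by rewrite -(shom_unit hiota) -usum !eE.
    rewrite (shom_add hiota (De _ _) (De _ _)) !iota_e USE.
    by rewrite (adjE (is_adjoint_comp (adw _) (adw _))).
have [phi [hphi phiu phis]] := Q2_universal hQ2 hA (Aw _) (Aw _) relA.
have phi_upow l : phi (upow u l) = w (ZPow2 l 0).
  have -> : phi (upow u l) = upow U l.
    case: l => n; first by rewrite (star_hom_iter n hQ hphi Qu) phiu.
    rewrite (star_hom_iter n.+1 hQ hphi (cstar_adjoint hQ Qu)).
    by rewrite (star_hom_adj hphi Qu) phiu.
  have UVK : cancel (adj U) U by move=> x; rewrite adjU UV.
  (* As (k + 1, 1) = (1, 1)(k, 1), the family [w (ZPow2 k 0)] obeys the recursion of [upowS], which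
     also runs downwards since [U] is injective. *)
  have wS k x : w (ZPow2 (k + 1) 0) x = U (w (ZPow2 k 0) x).
    by rewrite addrC -[RHS]/((w _ \o w _) x) -wM -[(_ * _)%g]/(ZPow2 (1 + 1 * k) 0) mul1r.
  apply/funext => x; elim/int_shift_ind: l => [|l IH|l].
  - by rewrite -[LHS]/(idfun x) -w1.
  - by rewrite upowS // wS IH.
  - by rewrite upowS // wS => /(can_inj (wK _)).
have phi_iter i : phi (iter i s) = w (ZPow2 0 i).
  rewrite (star_hom_iter i hQ hphi Qs) phis.
  elim: i => [|i IH]; first by rewrite -[LHS]/idfun -w1.
  by rewrite -[LHS]/(S \o iter i S) IH -wM.
have phi_mono l i : phi (monomial u s l i) = w (ZPow2 l i).
  rewrite (shom_mul hphi) ?phi_upow ?phi_iter; last exact: cstar_iter.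
    by rewrite -wM -[(_ * _)%g]/(ZPow2 (l + 1 * 0) i) mulr0 addr0.
  exact: (Qmono l 0%N).
have phi_e l i : phi (e l i) = iota (e l i).
  rewrite iota_e -phi_mono -(star_hom_adj hphi (Qmono l i)).
  exact: (shom_mul hphi (Qmono l i) (cstar_adjoint hQ (Qmono l i))).
have phi_iota a : D a -> phi a = iota a.
  apply: (eq_star_hom_gen hD erefl (star_hom_dom DQ hphi) hiota).
  by move=> _ [l [i ->]]; rewrite -eE.
have isom q : forall x, `|monomial u s (zshift q) (zexp q) x| = `|x|.
  have iter_isom n T : (forall y : H, `|T y| = `|y|) ->
      forall y, `|iter n T y| = `|y|.
    by move=> iT y; elim: n => //= n; rewrite iT.
  move=> x; case: q => [l i]; rewrite /monomial /=.
  rewrite -[RHS](iter_isom i _ (isometry_of_adjoint ads sK)).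
  case: l => n; apply: iter_isom; first exact: isometry_of_adjoint adu uK.
  exact: isometry_of_adjoint (is_adjoint_sym adu) uVK.
(* With the inclusion of [D] as representation, covariance is the definition of [alphaD]. *)
have covH : covariant_pair D (alphaD u s) id
    (fun q => monomial u s (zshift q) (zexp q)).
  split => //.
  - exact: star_hom_id hD (subset_trans DQ (cstar_bounded hQ)).
  - by move=> q; case: (cstar_bounded hQ (Qmono (zshift q) (zexp q))).
  - by move=> p q; rewrite monomialM.
have [rho [hrho rho_iota rho_w]] := cp_universal hcp covH.
(* So far [rho] takes values in all bounded operators on [H]; on generators of [A] they lie in
   [Q]. *)
have {}hrho : star_hom A Q rho.
  apply: (star_hom_gen_codom hA AE hQ hrho).
  move=> _ [[a Da <-]|[q _ <-]]; last by rewrite rho_w.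
  by rewrite rho_iota //; apply: DQ.
have phiK T : Q T -> rho (phi T) = T.
  apply: (eq_star_hom_gen hQ QE (star_hom_comp hphi hrho) (star_hom_id hQ (@subset_refl _ _))).
  (* u and s are the monomials with indices (1, 0) and (0, 1). *)
  by move=> _ [->|->] /=; rewrite ?phiu ?phis rho_w.
have rhoK T : A T -> phi (rho T) = T.
  apply: (eq_star_hom_gen hA AE (star_hom_comp hrho hphi) (star_hom_id hA (@subset_refl _ _))).
  move=> _ [[a Da <-]|[q _ <-]] /=; first by rewrite rho_iota // phi_iota.
  by rewrite rho_w phi_mono; case: q.
exists phi; split => //.
  split => //; split.
  - exact: shom_codom hphi.
  - by move=> T T' /[!inE] QT QT' /(congr1 rho); rewrite !phiK.
  - by move=> T AT; exists (rho T); [apply: shom_codom hrho _ AT|apply: rhoK].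
move=> psi hpsi psi_mono.
(* It is enough to compare on u and s, whose images are [w (ZPow2 1 0)] and [w (ZPow2 0 1)]. *)
apply: (eq_star_hom_gen hQ QE hpsi hphi) => _ [->|->].
- by rewrite phiu -(psi_mono 1 0%N).
- by rewrite phis -(psi_mono 0 1%N).
Qed.
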